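(* Let $d\ge 1$ and let $T$ be a $1$-dimensional metric current in $\mathbb{R}^d$ (with the Euclidean distance). Let $\tilde T$ be the classical $1$-current induced by $T$, i.e. $\langle \tilde T,\omega\rangle=\sum_{i=1}^d T(\omega_i,x_i)$ for every smooth compactly supported $1$-form $\omega=\sum_{i=1}^d\omega_i\,dx_i$. Then $\tilde T$ is a flat chain.
   Context: Metric currents: $\mathscr{D}^k(\mathbb{R}^d):=\mathrm{Lip}_b(\mathbb{R}^d)\times\mathrm{Lip}(\mathbb{R}^d)^k$, where $\mathrm{Lip}$ denotes real-valued Lipschitz functions and $\mathrm{Lip}_b$ the bounded ones. A $k$-dimensional metric current is a multilinear functional $T:\mathscr{D}^k\to\mathbb{R}$ such that: (i) (continuity) for every $f\in\mathrm{Lip}_b$ and sequences $\pi_i^n\to\pi_i$ pointwise ($i=1,\dots,k$) with $\mathrm{Lip}(\pi_i^n)\le C$ uniformly, $T(f,\pi_1^n,\dots,\pi_k^n)\to T(f,\pi_1,\dots,\pi_k)$; (ii) (locality) if some $\pi_i$ is constant on a neighbourhood of $\mathrm{supp} f$ then $T(f,\pi_1,\dots,\pi_k)=0$; (iii) (finite mass) there is a finite Radon measure $\mu$ with $|T(f,\pi_1,\dots,\pi_k)|\le \mathrm{Lip}(\pi_1)\cdots\mathrm{Lip}(\pi_k)\int|f|\,d\mu$. Here $x_i$ denotes the $i$-th coordinate function. Classical currents: a $k$-current is a continuous linear functional on smooth compactly supported $k$-forms; its mass $\mathbb{M}(T)$ is the supremum of $\langle T,\omega\rangle$ over forms with comass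 $\|\omega\|\le 1$; $\partial T$ is defined by $\langle\partial T,\omega\rangle=\langle T,d\omega\rangle$; $T$ is normal if $\mathbb{M}(T)+\mathbb{M}(\partial T)<\infty$. The flat norm of a current is $\mathbb{F}(T)=\sup\{\langle T,\omega\rangle:\max(\|\omega\|,\|d\omega\|)\le 1\}$ (sup norms of comass), which equals $\min\{\mathbb{M}(R)+\mathbb{M}(S):T=R+\partial S\}$. A (Federer–Fleming) flat chain is a current which is a limit in the flat norm $\mathbb{F}$ of normal currents. *)

(* Defs.v *)
From HB Require Import structures.
From mathcomp Require Import all_boot all_order all_algebra.
From mathcomp Require Import all_classical all_reals all_analysis.
Set Implicit Arguments. Unset Strict Implicit. Unset Printing Implicit Defensive.
Import Order.TTheory GRing.Theory Num.Theory.
Import numFieldNormedType.Exports.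
Local Open Scope classical_set_scope.
Local Open Scope ring_scope.

Section Defs.
Variables (R : realType) (d : nat).
Local Notation V := 'rV[R]_d.

Definition enorm (x : V) : R := Num.sqrt (\sum_(i < d) x ord0 i ^+ 2).

Definition coord (i : 'I_d) : V -> R := fun x => x ord0 i.

Definition lip_const_for (f : V -> R) (C : R) :=
  0 <= C /\ forall x y : V, `|f x - f y| <= C * enorm (x - y).
Definition is_lip (f : V -> R) := exists C, lip_const_for f C.
Definition Lip (f : V -> R) : R := inf [set C | lip_const_for f C].
Definition is_lipb (f : V -> R) := is_lip f /\ exists M, forall x, `|f x| <= M.

Definition supp (f : V -> R) : set V := closure [set x | f x != 0].

Definition BorelRd := g_sigma_algebraType (@open V).

Definition metric_current1 (T : (V -> R) -> (V -> R) -> R) : Prop :=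
  (forall f g pi a b, is_lipb f -> is_lipb g -> is_lip pi ->
     T (fun x => a * f x + b * g x) pi = a * T f pi + b * T g pi) /\
  (forall f pi rho a b, is_lipb f -> is_lip pi -> is_lip rho ->
     T f (fun x => a * pi x + b * rho x) = a * T f pi + b * T f rho) /\
  (forall f (pin : nat -> V -> R) pi C, is_lipb f -> is_lip pi ->
     (forall n, is_lip (pin n)) -> (forall n, Lip (pin n) <= C) ->
     (forall x, (fun n => pin n x) @ \oo --> pi x) ->
     (fun n => T f (pin n)) @ \oo --> T f pi) /\
  (forall f pi, is_lipb f -> is_lip pi ->
     (exists U : set V, open U /\ supp f `<=` U /\
        exists c, forall x, U x -> pi x = c) ->
     T f pi = 0) /\
  (exists mu : {measure set BorelRd -> \bar R},
     (mu setT < +oo)%E /\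
     forall f pi, is_lipb f -> is_lip pi ->
       ((`|T f pi|)%:E <= (Lip pi)%:E * \int[mu]_x (`|f x|)%:E)%E).

Definition ebasis (i : 'I_d) : V := \row_(j < d) (i == j)%:R.
Definition iterD (s : seq 'I_d) (f : V -> R) : V -> R :=
  foldr (fun i g => 'D_(ebasis i) g) f s.
Definition smooth (f : V -> R) :=
  forall s : seq 'I_d, continuous (iterD s f) /\
     forall (i : 'I_d) (x : V), derivable (iterD s f) x (ebasis i).
Definition test_fun (f : V -> R) := smooth f /\ compact (supp f).

Definition form1 := 'I_d -> V -> R.
Definition test_form1 (w : form1) := forall i, test_fun (w i).

Definition induced_current (T : (V -> R) -> (V -> R) -> R) : form1 -> R :=
  fun w => \sum_(i < d) T (w i) (coord i).

Definition partial (i : 'I_d) (f : V -> R) : V -> R := 'D_(ebasis i) f.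
Definition dform0 (f : V -> R) : form1 := fun i => partial i f.
Definition dform1_eval (w : form1) (x u v : V) : R :=
  \sum_(i < d) \sum_(j < d) partial i (w j) x * (u ord0 i * v ord0 j - u ord0 j * v ord0 i).
Definition comass1_le1 (w : form1) :=
  forall x, enorm (\row_(i < d) w i x) <= 1.
Definition comass_d_le1 (w : form1) :=
  forall x u v, enorm u <= 1 -> enorm v <= 1 -> dform1_eval w x u v <= 1.

Definition mass1 (S : form1 -> R) : \bar R :=
  ereal_sup [set (S w)%:E | w in [set w | test_form1 w /\ comass1_le1 w]].
Definition bmass1 (S : form1 -> R) : \bar R :=
  ereal_sup [set (S (dform0 f))%:E |
     f in [set f | test_fun f /\ forall x, `|f x| <= 1]].
Definition flat1 (S : form1 -> R) : \bar R :=
  ereal_sup [set (S w)%:E |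
     w in [set w | test_form1 w /\ comass1_le1 w /\ comass_d_le1 w]].

Definition linear_on_forms (S : form1 -> R) :=
  forall w1 w2 a b, test_form1 w1 -> test_form1 w2 ->
    S (fun i x => a * w1 i x + b * w2 i x) = a * S w1 + b * S w2.

Definition normal1 (N : form1 -> R) :=
  linear_on_forms N /\ (mass1 N < +oo)%E /\ (bmass1 N < +oo)%E.

Definition flat_chain1 (S : form1 -> R) :=
  exists N : nat -> form1 -> R, (forall k, normal1 (N k)) /\
    (fun k => flat1 (fun w => S w - N k w)) @ \oo --> 0%E.

End Defs.

(* Main.v *)
Require Import Defs.
From HB Require Import structures.
From mathcomp Require Import all_boot all_order all_algebra.
From mathcomp Require Import all_classical all_reals all_analysis.
From mathcomp Require Import measurable_realfun ring lra.
Set Implicit Arguments. Unset Strict Implicit. Unset Printing Implicit Defensive.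
Import Order.TTheory GRing.Theory Num.Theory.
Import numFieldNormedType.Exports.
Local Open Scope classical_set_scope.
Local Open Scope ring_scope.

(** Replace every component of a form by its average over the cube [x + [0, eps]^d]. Testing T
    against averaged forms gives a functional N_eps of finite mass, and its boundary has finite mass
    because averaging a derivative in direction i leaves a difference quotient of size at most
    [2 sup|f| / eps]. To compare N_eps with T in the flat norm, write, with [p] the integral of [w_j]
    over the segment from [x] to [x + t e_j],

      [w_i (x + t e_j) - w_i x = d_i p + O(t |dw|)].

    The second term is controlled by the mass of T. By the chain rule the first one contributes
    [T(1, p)], where [p] is uniformly Lipschitz and [|p| <= t], so the continuity axiom makes it small
    uniformly in [w].

    No integral over R^d is needed: averages are taken over finite grids and N_eps is a limit along an
    ultrafilter as the grid is refined; the discretization errors depend on [w] but vanish in the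
    limit. *)

(** * Lipschitz functions *)

Section Euclid.
Context {R : realType} {d : nat}.
Implicit Types (x y : 'rV[R]_d) (f : 'rV[R]_d -> R).

Lemma enorm_ge0 x : 0 <= enorm x.
Proof. exact: sqrtr_ge0. Qed.

Lemma coord_le_enorm x i : `|x ord0 i| <= enorm x.
Proof.
rewrite -sqrtr_sqr ler_wsqrtr// (bigD1 i)//= lerDl.
by apply: sumr_ge0 => j _; exact: sqr_ge0.
Qed.

Lemma enorm_le_sum x : enorm x <= \sum_(i < d) `|x ord0 i|.
Proof.
have s0 : 0 <= \sum_(i < d) `|x ord0 i| by apply: sumr_ge0.
rewrite -[leRHS]ger0_norm// -sqrtr_sqr ler_wsqrtr// expr2 mulr_suml.
apply: ler_sum => i _; rewrite -normr_id -real_normK ?num_real// expr2 normr_id.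
by rewrite ler_wpM2l// (bigD1 i)//= lerDl sumr_ge0.
Qed.

Lemma ebasisE (i j : 'I_d) : ebasis R i ord0 j = (i == j)%:R.
Proof. by rewrite mxE. Qed.

Lemma shiftE x (s : R) i j : (x + s *: ebasis R i) ord0 j = x ord0 j + s * (i == j)%:R.
Proof. by rewrite !mxE. Qed.

Lemma enorm_ebasis (s : R) (i : 'I_d) : enorm (s *: ebasis R i) <= `|s|.
Proof.
apply: le_trans (enorm_le_sum _) _; rewrite (bigD1 i)//= big1 ?addr0.
  by rewrite !mxE eqxx mulr1.
by move=> j /negPf ji; rewrite !mxE eq_sym ji mulr0 normr0.
Qed.

Lemma lip_const_Lip f (C : R) : lip_const_for f C -> Lip f <= C.
Proof. by move=> fC; apply: ge_inf => //; exists 0 => D /= []. Qed.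

Lemma lip_const_coord (i : 'I_d) : lip_const_for (@Defs.coord R d i) 1.
Proof.
by split => // x y; rewrite mul1r; have := coord_le_enorm (x - y) i; rewrite !mxE.
Qed.

Lemma is_lip_coord (i : 'I_d) : is_lip (@Defs.coord R d i).
Proof. by exists 1; exact: lip_const_coord. Qed.

Lemma lip_const_cst (c : R) : lip_const_for (fun _ : 'rV[R]_d => c) 0.
Proof. by split => // x y; rewrite subrr normr0 mul0r. Qed.

Lemma lip_constD f g (C D : R) : lip_const_for f C -> lip_const_for g D ->
  lip_const_for (fun x => f x + g x) (C + D).
Proof.
move=> [C0 fC] [D0 gD]; split; first exact: addr_ge0.
move=> x y; rewrite mulrDl opprD addrACA.
by apply: le_trans (ler_normD _ _) _; exact: lerD.
Qed.

Lemma lip_constZ a f (C : R) : lip_const_for f C ->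
  lip_const_for (fun x => a * f x) (`|a| * C).
Proof.
move=> [C0 fC]; split; first exact: mulr_ge0.
by move=> x y; rewrite -mulrBr normrM -mulrA ler_wpM2l.
Qed.

Lemma is_lipbZ a f : is_lipb f -> is_lipb (fun x => a * f x).
Proof.
move=> [[C fC] [M fM]]; split; first by exists (`|a| * C); exact: lip_constZ.
by exists (`|a| * M) => x; rewrite normrM ler_wpM2l.
Qed.

Lemma is_lipbD f g : is_lipb f -> is_lipb g -> is_lipb (fun x => f x + g x).
Proof.
move=> [[C fC] [M fM]] [[D gD] [N gN]]; split.
  by exists (C + D); exact: lip_constD.
by exists (M + N) => x; apply: le_trans (ler_normD _ _) _; exact: lerD.
Qed.

Lemma is_lipb_cst c : is_lipb (fun _ : 'rV[R]_d => c).
Proof.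
by split; [exists 0; exact: lip_const_cst | exists `|c|].
Qed.

Lemma is_lipbM f g : is_lipb f -> is_lipb g -> is_lipb (fun x => f x * g x).
Proof.
move=> [[C [C0 fC]] [M fM]] [[D [D0 gD]] [N gN]].
have M0 : 0 <= M by apply: le_trans (fM 0).
have N0 : 0 <= N by apply: le_trans (gN 0).
split; last by exists (M * N) => x; rewrite normrM ler_pM.
exists (C * N + M * D); split; first by rewrite addr_ge0// mulr_ge0.
move=> x y.
have -> : f x * g x - f y * g y = (f x - f y) * g x + f y * (g x - g y) by ring.
apply: le_trans (ler_normD _ _) _; rewrite [leRHS]mulrDl !normrM.
rewrite lerD//; last by rewrite -mulrA ler_pM.
by rewrite mulrAC ler_pM.
Qed.

Lemma is_lipb_sum (I : Type) (s : seq I) (P : pred I) (F : I -> 'rV[R]_d -> R) :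
  (forall i, is_lipb (F i)) -> is_lipb (fun x => \sum_(i <- s | P i) F i x).
Proof.
move=> Fl; elim: s => [|i s IH].
  rewrite (_ : (fun _ => _) = fun=> 0); first exact: is_lipb_cst.
  by apply/funext => x; rewrite big_nil.
case Pi : (P i).
  rewrite (_ : (fun _ => _) = fun x => F i x + \sum_(i <- s | P i) F i x).
    exact: is_lipbD.
  by apply/funext => x; rewrite big_cons Pi.
by under eq_fun do rewrite big_cons Pi.
Qed.

Lemma is_lipb_prod (I : Type) (s : seq I) (P : pred I) (F : I -> 'rV[R]_d -> R) :
  (forall i, is_lipb (F i)) -> is_lipb (fun x => \prod_(i <- s | P i) F i x).
Proof.
move=> Fl; elim: s => [|i s IH].
  rewrite (_ : (fun _ => _) = fun=> 1); first exact: is_lipb_cst.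
  by apply/funext => x; rewrite big_nil.
case Pi : (P i).
  rewrite (_ : (fun _ => _) = fun x => F i x * \prod_(i <- s | P i) F i x).
    exact: is_lipbM.
  by apply/funext => x; rewrite big_cons Pi.
by under eq_fun do rewrite big_cons Pi.
Qed.

(** Pass from [y] to [x] by replacing one coordinate at a time; each of the [d] moves has length at
    most [enorm (x - y)]. The factor [d] is not sharp, but it depends on the dimension only. *)
Lemma lip_coordwise f (C : R) : 0 <= C ->
  (forall i x s, `|f (x + s *: ebasis R i) - f x| <= C * `|s|) ->
  lip_const_for f (d%:R * C).
Proof.
move=> C0 fC; split; first exact: mulr_ge0.
move=> x y.
(* The first [k] coordinates come from [x], the others from [y]. *)
pose z k : 'rV[R]_d := \row_j (if (j < k)%N then x ord0 j else y ord0 j).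
have zd : z d = x by apply/rowP => j; rewrite mxE ltn_ord.
have z0 : z 0%N = y by apply/rowP => j; rewrite mxE.
suff H k : (k <= d)%N -> `|f (z k) - f y| <= k%:R * C * enorm (x - y).
  by rewrite -{1}zd H.
elim: k => [_|k IH kd]; first by rewrite z0 subrr normr0 !mul0r.
pose i := Ordinal kd.
have -> : z k.+1 = z k + (x ord0 i - y ord0 i) *: ebasis R i.
  apply/rowP => j; rewrite !mxE ltnS -val_eqE /= eq_sym leq_eqVlt.
  case: eqVneq => [jk|_]; last by rewrite mulr0 addr0.
  have -> : j = i by apply: val_inj.
  by rewrite ltnn/=; ring.
rewrite (_ : forall a, a - f y = (a - f (z k)) + (f (z k) - f y)); last by move=> a; ring.
apply: le_trans (ler_normD _ _) _.
rewrite -natr1 mulrDl mul1r mulrDl addrC lerD ?IH 1?ltnW//.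
apply: le_trans (fC _ _ _) _; rewrite ler_wpM2l//.
by have := coord_le_enorm (x - y) i; rewrite !mxE.
Qed.

(** The topology on row vectors comes from the sup norm, so the Euclidean norm is first compared
    with it. *)
Lemma lip_const_continuous f (C : R) : lip_const_for f C -> continuous f.
Proof.
move=> [C0 fC] x; apply/(@cvgrPdist_le _ _ _ (nbhs x)) => e e0.
have nx (y : 'rV[R]_d) : enorm y <= d%:R * `|y|.
  apply: le_trans (enorm_le_sum _) _.
  have -> : d%:R * `|y| = \sum_(i < d) `|y| by rewrite sumr_const card_ord mulr_natl.
  apply: ler_sum => i _; rewrite [leRHS]mx_normrE.
  exact: (le_bigmax _ (fun ij => `|y ij.1 ij.2|) (ord0, i)).
(* Adding 1 keeps the constant invertible when [C * d] vanishes. *)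
have K0 : 0 < C * d%:R + 1 by rewrite ltr_wpDl// mulr_ge0.
have r0 : 0 < (C * d%:R + 1)^-1 * e by rewrite mulr_gt0// invr_gt0.
have := nbhsx_ballx x _ r0; rewrite -ball_normE; apply: filterS => y /= /ltW.
rewrite ler_pdivlMl// => xy.
apply: le_trans (fC _ _) _; apply: le_trans xy.
apply: (@le_trans _ _ (C * (d%:R * `|x - y|))); first by rewrite ler_wpM2l.
by rewrite mulrA ler_wpM2r// lerDl.
Qed.

Lemma is_lipb_continuous f : is_lipb f -> continuous f.
Proof. by move=> [[C fC] _]; exact: lip_const_continuous fC. Qed.

End Euclid.

(** * Discrete averages *)

Section Average.
Context {R : realType} {d : nat}.
Local Notation V := 'rV[R]_d.
Implicit Types (f : V -> R) (g : 'I_d -> V -> R).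

(** Left Riemann sum, with [n.+1] nodes, for the mean of [f] over the segment from [x] to
    [x + t e_j]. *)
Definition avg (j : 'I_d) (t : R) (n : nat) f : V -> R := fun x =>
  n.+1%:R^-1 * \sum_(k < n.+1) f (x + (k%:R * (t / n.+1%:R)) *: ebasis R j).

Definition avgs (l : seq 'I_d) (t : R) (n : nat) f : V -> R :=
  foldr (fun j h => avg j t n h) f l.

(* Functions of class C^{1,1} supported in the cube of half-side [M], with gradient [g]; a single constant [L]
   serves for all bounds, so that translations and averages preserve it. *)
Record c11 (L M : R) f g : Prop := C11 {
  c11_ge0 : 0 <= L;
  c11_lip : forall x y, `|f x - f y| <= L * enorm (x - y);
  c11_bnd : forall x, `|f x| <= L;
  c11_glip : forall i x y, `|g i x - g i y| <= L * enorm (x - y);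
  c11_gbnd : forall i x, `|g i x| <= L;
  c11_step : forall i x s,
    `|f (x + s *: ebasis R i) - f x - s * g i x| <= L * s ^+ 2;
  c11_supp : forall (x : V) i, M < `|x ord0 i| -> f x = 0;
  c11_gsupp : forall j (x : V) i, M < `|x ord0 i| -> g j x = 0 }.

Lemma ler_mean (n : nat) (a : 'I_n.+1 -> R) C :
  (forall k, `|a k| <= C) -> `|n.+1%:R^-1 * \sum_(k < n.+1) a k| <= C.
Proof.
move=> aC; rewrite normrM gtr0_norm ?invr_gt0// ler_pdivrMl//.
apply: le_trans (ler_norm_sum _ _ _) _.
have -> : n.+1%:R * C = \sum_(k < n.+1) C by rewrite sumr_const card_ord mulr_natl.
exact: ler_sum.
Qed.

Lemma mean_cst (n : nat) (c : R) : n.+1%:R^-1 * \sum_(k < n.+1) c = c.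
Proof.
by rewrite sumr_const card_ord -[c *+ _]mulr_natl mulKf// pnatr_eq0.
Qed.

Lemma mean_le1 (n : nat) (k : 'I_n.+1) (t : R) : 0 <= t <= 1 ->
  `|k%:R * (t / n.+1%:R)| <= 1.
Proof.
move=> /andP[t0 t1]; rewrite ger0_norm; last by rewrite mulr_ge0// divr_ge0.
rewrite mulrCA -[leRHS]mulr1 ler_pM// ?divr_ge0//.
by rewrite ler_pdivrMr// mul1r ler_nat ltnW.
Qed.

Lemma avg_bnd j t n f C : (forall x, `|f x| <= C) -> forall x, `|avg j t n f x| <= C.
Proof. by move=> fC x; exact: ler_mean. Qed.

Lemma avg_lip j t n f C : (forall x y, `|f x - f y| <= C * enorm (x - y)) ->
  forall x y, `|avg j t n f x - avg j t n f y| <= C * enorm (x - y).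
Proof.
move=> fC x y; rewrite /avg -mulrBr -sumrB; apply: ler_mean => k.
by apply: le_trans (fC _ _) _; rewrite opprD addrACA subrr addr0.
Qed.

(** All bounds of [c11] survive translations and convex combinations; only the support grows, by at
    most 1 since the shifts have length at most [t <= 1]. *)
Lemma c11_avg L M f g j t n : 0 <= t <= 1 -> c11 L M f g ->
  c11 L (M + 1) (avg j t n f) (fun i => avg j t n (g i)).
Proof.
move=> t01 [L0 fl fb gl gb st sf sg].
have far (x : V) i (k : 'I_n.+1) : M + 1 < `|x ord0 i| ->
    M < `|(x + (k%:R * (t / n.+1%:R)) *: ebasis R j) ord0 i|.
  rewrite shiftE => Mx; have := mean_le1 k t01; set s := _ * (t / _) => s1.
  have : `|x ord0 i| <= `|x ord0 i + s * (j == i)%:R| + `|s * (j == i)%:R|.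
    by rewrite -[X in _ + X]normrN; apply: le_trans (ler_normD _ _); rewrite addrK.
  have : `|s * (j == i)%:R| <= 1 by case: eqP; rewrite ?mulr1// mulr0 normr0.
  lra.
split=> //.
- exact: avg_lip.
- by move=> x; exact: avg_bnd.
- by move=> i; exact: avg_lip.
- by move=> i x; exact: avg_bnd.
- move=> i x s; rewrite /avg mulrCA -mulrBr -mulrBr mulr_sumr -!sumrB.
  by apply: ler_mean => k; rewrite [x + _ + _]addrAC.
- move=> x i Mx; rewrite /avg big1 ?mulr0// => k _; exact/sf/far/Mx.
- move=> i' x i Mx; rewrite /avg big1 ?mulr0// => k _; exact/sg/far/Mx.
Qed.

Lemma c11_avgs L M f g l t n : 0 <= t <= 1 -> c11 L M f g ->
  c11 L (M + (size l)%:R) (avgs l t n f) (fun i => avgs l t n (g i)).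
Proof.
move=> t01 fg; elim: l => [|j l IH]; first by rewrite addr0.
by rewrite /= -natr1 addrA; exact: c11_avg.
Qed.

Lemma c11_le L M L' M' f g : L <= L' -> M <= M' -> c11 L M f g -> c11 L' M' f g.
Proof.
move=> LL MM [L0 fl fb gl gb st sf sg]; split.
- exact: le_trans LL.
- by move=> x y; apply: le_trans (fl x y) _; rewrite ler_wpM2r// enorm_ge0.
- by move=> x; exact: le_trans (fb x) LL.
- by move=> i x y; apply: le_trans (gl i x y) _; rewrite ler_wpM2r// enorm_ge0.
- by move=> i x; exact: le_trans (gb i x) LL.
- by move=> i x s; apply: le_trans (st i x s) _; rewrite ler_wpM2r// sqr_ge0.
- by move=> x i Mx; apply: (sf x i); exact: le_lt_trans Mx.
- by move=> j x i Mx; apply: (sg j x i); exact: le_lt_trans Mx.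
Qed.

Lemma avgs_lin l t n f h a b x :
  avgs l t n (fun y => a * f y + b * h y) x = a * avgs l t n f x + b * avgs l t n h x.
Proof.
elim: l x => //= j l IH x; rewrite /avg; under eq_bigr do rewrite IH.
by rewrite big_split /= -!mulr_sumr; ring.
Qed.

Lemma c11Z L M f g a : `|a| <= 1 -> c11 L M f g ->
  c11 L M (fun x => a * f x) (fun i x => a * g i x).
Proof.
move=> a1 [L0 fl fb gl gb st sf sg].
have H z C : 0 <= C -> `|z| <= C -> `|a * z| <= C.
  by move=> C0 zC; rewrite normrM -[leRHS]mul1r ler_pM.
split=> //.
- by move=> x y; rewrite -mulrBr H// mulr_ge0// enorm_ge0.
- by move=> x; exact: H.
- by move=> i x y; rewrite -mulrBr H// mulr_ge0// enorm_ge0.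
- by move=> i x; exact: H.
- by move=> i x s; rewrite mulrCA -!mulrBr H// mulr_ge0// sqr_ge0.
- by move=> x i /sf ->; rewrite mulr0.
- by move=> j x i /sg ->; rewrite mulr0.
Qed.

Lemma c11_is_lipb L M f g : c11 L M f g -> is_lipb f.
Proof. by case=> L0 fl fb *; split; exists L. Qed.

Lemma c11_grad_is_lipb L M f g i : c11 L M f g -> is_lipb (g i).
Proof. by case=> L0 _ _ gl gb *; split; exists L => //; split => //; exact: gl. Qed.

Lemma avgs_bnd l t n f C : (forall x, `|f x| <= C) -> forall x, `|avgs l t n f x| <= C.
Proof. by move=> fC; elim: l => //= j l IH; exact: avg_bnd. Qed.

(** This discards discretization errors: [C] may depend on everything but [n]. *)
Lemma le_of_leD_divn (a b C : R) : (forall n : nat, a <= b + C / n.+1%:R) -> a <= b.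
Proof.
move=> H; apply/ler_addgt0Pr => e e0.
have [C0|C0] := lerP C 0.
  apply: le_trans (H 0%N) _; rewrite divr1; lra.
pose n := Num.trunc (C / e).
have nC : C / e < n.+1%:R by rewrite truncnS_gt.
apply: le_trans (H n) _; rewrite lerD2l ler_pdivrMr// mulrC -ler_pdivrMr//.
exact: ltW.
Qed.

(** A discrete fundamental theorem of calculus: the increment telescopes into [n.+1] steps of length
    [h = t / n.+1], each with error [L h^2] by [c11_step]. *)
Lemma c11_riemann L M f g i t n x : c11 L M f g ->
  `|f (x + t *: ebasis R i) - f x - t * avg i t n (g i) x| <= L * t ^+ 2 / n.+1%:R.
Proof.
case=> L0 _ _ _ _ st _ _.
pose h := t / n.+1%:R; pose u (k : nat) := f (x + (k%:R * h) *: ebasis R i).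
have n0 : n.+1%:R != 0 :> R by rewrite pnatr_eq0.
have nh : n.+1%:R * h = t by rewrite mulrC divfK.
have -> : f (x + t *: ebasis R i) - f x = \sum_(k < n.+1) (u k.+1 - u k).
  by rewrite -(big_mkord xpredT (fun k => u k.+1 - u k)) telescope_sumr// /u mul0r scale0r addr0 nh.
rewrite /avg mulrA -/h mulr_sumr -sumrB.
have -> : L * t ^+ 2 / n.+1%:R = \sum_(k < n.+1) L * h ^+ 2.
  by rewrite sumr_const card_ord -[RHS]mulr_natl /h; field; rewrite addrC natr1.
apply: le_trans (ler_norm_sum _ _ _) _; apply: ler_sum => k _.
by rewrite /u -natr1 mulrDl mul1r scalerDl addrA; exact: st.
Qed.

(** The constant involves the gradient bound [G] only: [L] enters through a Riemann error that tends
    to 0 as the grid is refined. *)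
Lemma c11_lip_of_grad L M f g G : 0 <= G -> c11 L M f g ->
  (forall i x, `|g i x| <= G) -> lip_const_for f (d%:R * G).
Proof.
move=> G0 fg gG; apply: lip_coordwise => // i x s.
apply: (@le_of_leD_divn _ _ (L * s ^+ 2)) => n.
have := c11_riemann i s n x fg.
set a := f _ - _; set b := s * _; set c := _ / _ => abc.
have : `|b| <= G * `|s| by rewrite /b normrM mulrC ler_wpM2r// avg_bnd.
have : `|a| <= `|a - b| + `|b| by apply: le_trans (ler_normD _ _); rewrite subrK.
lra.
Qed.

(** The average in direction [i] turns the [i]-th derivative into a difference quotient of a
    function bounded by [B], up to the Riemann error; the averages in the other directions preserve
    sup bounds. This yields the finite boundary mass. *)
Lemma avgs_grad_bnd L M f g l t n i B x : 0 < t <= 1 -> i \in l -> c11 L M f g ->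
  (forall x, `|f x| <= B) -> `|avgs l t n (g i) x| <= (B + B) / t + L * t / n.+1%:R.
Proof.
move=> /andP[t0 t1] il fg fB; elim: l il x => // j l IH.
have t01 : 0 <= t <= 1 by rewrite ltW.
rewrite in_cons; case: (eqVneq i j) => [<- _|_ /= il]; last by move=> x; exact/avg_bnd/IH.
move=> x /=; have {}fg := c11_avgs l n t01 fg.
have := c11_riemann i t n x fg; rewrite -/(avgs l t n (g i)).
move: (avgs_bnd l t n fB) => {}fB.
set a := avgs l t n f _; set b := avgs l t n f _; set c := avg _ _ _ _ _ => abc.
rewrite -(ler_pM2l t0) mulrDr (mulrCA t (B + B)) divff ?gt_eqF// mulr1.
have -> : t * (L * t / n.+1%:R) = L * t ^+ 2 / n.+1%:R by rewrite expr2; field; rewrite addrC natr1.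
rewrite -{1}(gtr0_norm t0) -normrM.
have -> : t * c = a - b - (a - b - t * c) by ring.
apply: le_trans (ler_normB _ _) _; rewrite lerD//.
by apply: le_trans (ler_normB _ _) _; exact: lerD (fB _) (fB _).
Qed.

End Average.

(** * Test functions and comass *)

Section TestFunctions.
Context {R : realType} {d : nat}.
Local Notation V := 'rV[R]_d.
Implicit Types (f : V -> R).

Lemma is_derive_line f (x v : V) (u : R) : derivable f (x + u *: v) v ->
  is_derive u 1 (fun s => f (x + s *: v)) ('D_v f (x + u *: v)).
Proof.
move=> df; set phi := fun s : R => _.
have E : (fun h : R => h^-1 *: ((phi \o shift u) (h *: (1 : R)) - phi u)) =
         (fun h : R => h^-1 *: ((f \o shift (x + u *: v)) (h *: v) - f (x + u *: v))).
  apply/funext => h /=; congr (_ *: (_ - _)).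
  have -> : h *: (1 : R) = h by exact: mulr1.
  by rewrite /phi /= scalerDl addrCA.
split; first by rewrite /derivable E.
by rewrite /derive E.
Qed.

(** Locating [c] only by [|c| <= |s|] treats both signs of [s] alike. *)
Lemma MVT_line f (v : V) (x : V) (s : R) : (forall x, derivable f x v) ->
  exists2 c, `|c| <= `|s| & f (x + s *: v) - f x = s * 'D_v f (x + c *: v).
Proof.
move=> df; pose phi (u : R) := f (x + u *: v).
have dphi (u : R) : is_derive u 1 phi ('D_v f (x + u *: v)) by exact: is_derive_line.
have cphi : continuous phi.
  by move=> u; apply/differentiable_continuous/derivable1_diffP; case: (dphi u).
have phi0 : phi 0 = f x by rewrite /phi scale0r addr0.
have [s0|s0] := lerP 0 s.
  have [] := @MVT_segment R phi (fun u => 'D_v f (x + u *: v)) 0 s s0 => //.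
    exact: continuous_subspaceT.
  move=> c; rewrite in_itv /= => /andP[c0 cs]; rewrite phi0 subr0 => E.
  by exists c; rewrite ?ger0_norm// -/(phi s) E mulrC.
have [] := @MVT_segment R phi (fun u => 'D_v f (x + u *: v)) s 0 (ltW s0) => //.
  exact: continuous_subspaceT.
move=> c; rewrite in_itv /= => /andP[sc c0]; rewrite phi0 sub0r => E.
exists c; first by rewrite ler0_norm// ltr0_norm// lerN2.
by rewrite -/(phi s) -opprB E; ring.
Qed.

(** The complement of the support is open, so vanishing there passes to derivatives, which are
    local. *)
Lemma iterD_supp f s x : ~ supp f x -> Defs.iterD s f x = 0.
Proof.
have oS : open (~` supp f) by rewrite openC; exact: closed_closure.
elim: s x => [|i s IH] x Sx /=.
  by apply/eqP; apply: contrapT => /negP fx; apply/Sx/subset_closure.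
have -> : 0 = 'D_(ebasis R i) (cst 0 : V -> R) x by rewrite derive_cst.
apply: near_eq_derive; apply: (filterS IH).
exact: open_nbhs_nbhs.
Qed.

Lemma test_fun_iterD_bounded f s : test_fun f ->
  exists B, 0 <= B /\ forall x, `|Defs.iterD s f x| <= B.
Proof.
move=> [sf cf]; have [cs _] := sf s.
have /compact_bounded/pinfty_ex_gt0 [B B0 HB] : compact (Defs.iterD s f @` supp f).
  by apply: continuous_compact => //; exact: continuous_subspaceT.
exists B; split=> [|x]; first exact: ltW.
have [Sx|Sx] := pselect (supp f x); first by apply: HB; exists x.
by rewrite iterD_supp// normr0 ltW.
Qed.

Lemma test_fun_c11 f : test_fun f -> exists L M, c11 L M f (fun i => partial i f).
Proof.
move=> tf; have [sf cf] := tf.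
have /choice [B HB] := fun s => test_fun_iterD_bounded s tf.
have B0 s : 0 <= B s by case: (HB s).
have {}HB s x : `|Defs.iterD s f x| <= B s by case: (HB s).
(* One bound for [f] and its first and second derivatives; the factor [d.+1] used below absorbs the
   [d] of [lip_coordwise] and still dominates [K] itself. *)
pose K := B [::] + \sum_i B [:: i] + \sum_i \sum_j B [:: i; j].
have S1 : 0 <= \sum_i B [:: i] by exact: sumr_ge0.
have S2 : 0 <= \sum_i \sum_j B [:: i; j] by apply: sumr_ge0 => i _; exact: sumr_ge0.
have K0 : B [::] <= K by rewrite /K; lra.
have K1 i : B [:: i] <= K.
  have : B [:: i] <= \sum_i B [:: i] by rewrite (bigD1 i)//= lerDl sumr_ge0.
  by have := B0 [::]; rewrite /K; lra.
have K2 i j : B [:: i; j] <= K.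
  have : B [:: i; j] <= \sum_i \sum_j B [:: i; j].
    rewrite (bigD1 i)//= (bigD1 j)//= -addrA lerDl addr_ge0 ?sumr_ge0// => k _.
    by apply: sumr_ge0 => l _.
  by have := B0 [::]; rewrite /K; lra.
have Kge0 : 0 <= K := le_trans (B0 _) K0.
have KL : K <= d.+1%:R * K by rewrite ler_peMl// ler1n.
have dL : d%:R * K <= d.+1%:R * K by rewrite ler_wpM2r// ler_nat.
have step s i x (u : R) : (forall i x, `|Defs.iterD (i :: s) f x| <= K) ->
    `|Defs.iterD s f (x + u *: ebasis R i) - Defs.iterD s f x| <= K * `|u|.
  move=> HK; have [c _ ->] := MVT_line x u ((sf s).2 i).
  by rewrite normrM mulrC ler_wpM2r//; exact: HK.
have lip s : (forall i x, `|Defs.iterD (i :: s) f x| <= K) -> forall x y,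
    `|Defs.iterD s f x - Defs.iterD s f y| <= d.+1%:R * K * enorm (x - y).
  move=> HK x y.
  have [_ H] : lip_const_for (Defs.iterD s f) (d%:R * K).
    by apply: lip_coordwise => // i {}x u; exact: step.
  by apply: le_trans (H _ _) _; rewrite ler_wpM2r// enorm_ge0.
have H0 x : `|f x| <= K := le_trans (HB [::] x) K0.
have H1 i x : `|Defs.iterD [:: i] f x| <= K := le_trans (HB _ x) (K1 i).
have H2 i j x : `|Defs.iterD [:: i; j] f x| <= K := le_trans (HB _ x) (K2 i j).
have /compact_bounded/pinfty_ex_gt0 [M M0 HM] := cf.
have far (x : V) i : M < `|x ord0 i| -> ~ supp f x.
  move=> Mx /HM /= xM; move: Mx; rewrite ltNge => /negP; apply.
  apply: le_trans xM; rewrite [leRHS]mx_normrE.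
  exact: (le_bigmax _ (fun ij => `|x ij.1 ij.2|) (ord0, i)).
exists (d.+1%:R * K), M; split.
- by rewrite mulr_ge0.
- exact: (lip [::]).
- by move=> x; exact: le_trans (H0 x) KL.
- by move=> i; apply: (lip [:: i]) => j x; exact: H2.
- by move=> i x; exact: le_trans (H1 i x) KL.
(* First-order Taylor estimate: the derivative at the intermediate point differs from that at [x] by
   at most [K |c| <= K |s|]. *)
- move=> i x s; have [c cs ->] := MVT_line x s ((sf [::]).2 i).
  rewrite -mulrBr normrM.
  apply: (@le_trans _ _ (`|s| * (K * `|s|))).
    rewrite ler_wpM2l//; apply: le_trans (step [:: i] i x c _) _ => //.
    by rewrite ler_wpM2l.
  by rewrite mulrCA -expr2 real_normK ?num_real// ler_wpM2r// sqr_ge0.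
- by move=> x i /far; exact: (@iterD_supp f [::]).
- by move=> j x i /far; exact: (@iterD_supp f [:: j]).
Qed.

Lemma dform1_eval_ebasis (w : form1 R d) x (i j : 'I_d) :
  dform1_eval w x (ebasis R i) (ebasis R j) = partial i (w j) x - partial j (w i) x.
Proof.
have pick (F : 'I_d -> R) (k : 'I_d) : \sum_a F a * (k == a)%:R = F k.
  rewrite (bigD1 k)//= eqxx mulr1 big1 ?addr0// => a /negPf ak.
  by rewrite eq_sym ak mulr0.
rewrite /dform1_eval.
have inner a : \sum_(b < d) partial a (w b) x *
      (ebasis R i ord0 a * ebasis R j ord0 b - ebasis R i ord0 b * ebasis R j ord0 a) =
    partial a (w j) x * (i == a)%:R - partial a (w i) x * (j == a)%:R.
  rewrite -(pick (fun b => partial a (w b) x * (i == a)%:R)).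
  rewrite -(pick (fun b => partial a (w b) x * (j == a)%:R)) -sumrB.
  by apply: eq_bigr => b _; rewrite !ebasisE; ring.
by under eq_bigr do rewrite inner; rewrite sumrB !pick.
Qed.

Lemma comass1_le1_coord (w : form1 R d) i x : comass1_le1 w -> `|w i x| <= 1.
Proof.
move=> /(_ x); apply: le_trans.
by have := coord_le_enorm (\row_(i < d) w i x) i; rewrite mxE.
Qed.

(** The comass condition is one-sided; testing it on [(e_i, e_j)] and on [(e_j, e_i)] gives the
    absolute value. *)
Lemma comass_d_le1_coord (w : form1 R d) i j x : comass_d_le1 w ->
  `|partial i (w j) x - partial j (w i) x| <= 1.
Proof.
have e1 (k : 'I_d) : enorm (ebasis R k) <= 1.
  by have := enorm_ebasis (1 : R) k; rewrite scale1r normr1.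
move=> wd; rewrite ler_norml.
have := wd x _ _ (e1 i) (e1 j); have := wd x _ _ (e1 j) (e1 i).
rewrite !dform1_eval_ebasis; lra.
Qed.

End TestFunctions.

(** * The mass measure *)

Section Mass.
Context {R : realType} {d : nat}.
Local Notation V := 'rV[R]_d.

Lemma continuous_measurable_Borel (f : V -> R) : continuous f ->
  measurable_fun setT (f : BorelRd R d -> R).
Proof.
move=> cf; apply: (measurability _ (RGenOpens.measurableE R)).
move=> _ [_ [a [b ->]] <-]; rewrite setTI.
apply: sub_sigma_algebra.
by move/continuousP: cf; apply; exact: interval_open.
Qed.

(* [I f] plays the role of the integral of [|f|] against the mass measure, and [m] that of its total mass. *)
Record mass_bound (T : (V -> R) -> (V -> R) -> R) (I : (V -> R) -> R) (m : R) : Prop := MassBound {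
  mass_ge0 : 0 <= m;
  mass_le : forall f pi C, is_lipb f -> lip_const_for pi C -> `|T f pi| <= C * I f;
  mass_mono : forall f g K, is_lipb f -> is_lipb g -> 0 <= K ->
    (forall x, `|f x| <= K * `|g x|) -> I f <= K * I g;
  mass_sum : forall (J : finType) (Phi : J -> V -> R), (forall j, is_lipb (Phi j)) ->
    (forall j x, 0 <= Phi j x) -> (forall x, \sum_j Phi j x <= 1) ->
    \sum_j I (Phi j) <= m }.

Lemma metric_current1_mass (T : (V -> R) -> (V -> R) -> R) : metric_current1 T ->
  exists I m, mass_bound T I m.
Proof.
move=> [_ [_ [_ [_ [mu [muT Tmu]]]]]].
have mT : mu setT \is a fin_num by rewrite ge0_fin_numE.
have mf (f : V -> R) : is_lipb f -> measurable_fun setT (fun x : BorelRd R d => (`|f x|)%:E).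
  move=> lf; apply/measurable_EFinP/measurableT_comp => //.
  exact: (continuous_measurable_Borel (is_lipb_continuous lf)).
have intb (f : V -> R) K : is_lipb f -> 0 <= K -> (forall x, `|f x| <= K) ->
    (\int[mu]_x (`|f x|)%:E <= K%:E * mu setT)%E.
  move=> lf K0 fK; rewrite -integral_cst//.
  apply: ge0_le_integral => //.
  - exact: mf.
  - by move=> x _; rewrite lee_fin.
have intfin (f : V -> R) : is_lipb f -> (\int[mu]_x (`|f x|)%:E)%E \is a fin_num.
  move=> lf; rewrite ge0_fin_numE; last by apply: integral_ge0 => x _; rewrite lee_fin.
  have [_ [K fK]] := lf; have K0 : 0 <= K := le_trans (normr_ge0 _) (fK 0).
  apply: le_lt_trans (intb f K lf K0 fK) _.
  by rewrite -(fineK mT) -EFinM ltry.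
(* [fine] loses nothing here: bounded Lipschitz functions have finite integral against a finite
   measure. *)
exists (fun f => fine (\int[mu]_x (`|f x|)%:E)%E), (fine (mu setT)); split.
- by apply: fine_ge0; exact: measure_ge0.
- move=> f pi C lf piC.
  have lpi : is_lip pi by exists C.
  have := Tmu f pi lf lpi; rewrite -(fineK (intfin f lf)) -EFinM lee_fin => H.
  apply: le_trans H _; rewrite ler_wpM2r//; last exact: lip_const_Lip.
  by apply/fine_ge0/integral_ge0 => x _; rewrite lee_fin.
- move=> f g K lf lg K0 fg.
  rewrite -lee_fin EFinM !fineK ?intfin// -ge0_integralZl//.
  + apply: ge0_le_integral => //.
    * exact: mf.
    * by apply: measurable_funeM; exact: mf.
    * by move=> x _; rewrite -EFinM lee_fin.
  + exact: mf.
- move=> J Phi lP P0 P1; rewrite -lee_fin -sumEFin (eq_bigr (fun j => (\int[mu]_x (`|Phi j x|)%:E)%E)).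
    rewrite -ge0_integral_sum//; last by move=> j; exact: mf.
    rewrite fineK// -[leRHS]mul1e -integral_cst//.
    apply: ge0_le_integral => //.
    + by move=> x _; apply: sume_ge0 => j _; rewrite lee_fin.
    + by apply: emeasurable_sum => j _; exact: mf.
    + move=> x _; rewrite sumEFin lee_fin (le_trans _ (P1 x))//.
      by apply: ler_sum => j _; rewrite ger0_norm.
  by move=> j _; rewrite fineK// intfin.
Qed.

End Mass.

(** * Partition of unity *)

Section Cut.
Context {R : realType}.
Implicit Types (a b s t : R).

Definition cut a b t : R := Num.max a (Num.min b t).

Lemma cut_itv a b t : a <= b -> a <= cut a b t <= b.
Proof. by move=> ab; rewrite /cut le_max lexx ge_max ab ge_min lexx. Qed.

Lemma cut_id a b t : a <= t <= b -> cut a b t = t.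
Proof. by move=> /andP[at_ tb]; rewrite /cut (min_idPr tb) (max_idPr at_). Qed.

Lemma cut_left a b t : a <= b -> t <= a -> cut a b t = a.
Proof. by move=> ab ta; rewrite /cut (min_idPr (le_trans ta ab)) (max_idPl ta). Qed.

Lemma cut_right a b t : a <= b -> b <= t -> cut a b t = b.
Proof. by move=> ab bt; rewrite /cut (min_idPl bt) (max_idPr ab). Qed.

Lemma le_cut a b s t : s <= t -> cut a b s <= cut a b t.
Proof. by move=> st; apply: le_max2; [exact: lexx|apply: le_min2]. Qed.

Lemma cut_dist a b s t : `|cut a b s - cut a b t| <= `|s - t|.
Proof.
wlog st : s t / t <= s.
  move=> H; case/orP: (le_total t s) => /H // {}H.
  by rewrite distrC [`|s - t|]distrC.
rewrite !ger0_norm ?subr_ge0 ?le_cut//.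
rewrite /cut /Num.max /Num.min.
by do 4?case: ifPn => //; rewrite -?leNgt => *; lra.
Qed.

(** The hat function on [[k, k + 2]] with peak 1 at [k + 1], written as a difference of clamps so
    that sums over [k] telescope. *)
Definition tent (k : nat) t : R := cut 0 1 (t - k%:R) - cut 0 1 (t - k.+1%:R).

Lemma tent_ge0 k t : 0 <= tent k t.
Proof. by rewrite subr_ge0 le_cut// lerD2l lerN2 ler_nat. Qed.

Lemma tent_supp k t : tent k t != 0 -> k%:R <= t <= k%:R + 2.
Proof.
apply: contraNT; rewrite negb_and -!ltNge => /orP[tk|kt]; rewrite /tent -natr1.
  by rewrite !cut_left ?subrr//; lra.
by rewrite !cut_right ?subrr//; lra.
Qed.

Lemma sum_tent n t : \sum_(k < n) tent k t = cut 0 1 t - cut 0 1 (t - n%:R).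
Proof.
rewrite -(big_mkord xpredT (fun k => tent k t)).
rewrite (telescope_sumr_eq (fun k : nat => - cut 0 1 (t - k%:R))) ?subr0.
- by rewrite opprK addrC.
- by [].
- by move=> k _; rewrite opprK addrC.
Qed.

Lemma sum_tent_itv n t : 0 <= \sum_(k < n) tent k t <= 1.
Proof.
rewrite sumr_ge0/=; last by move=> k _; exact: tent_ge0.
rewrite sum_tent; have := @cut_itv 0 1 t ler01; have := @cut_itv 0 1 (t - n%:R) ler01.
lra.
Qed.

Lemma sum_tent1 n t : 1 <= t <= n%:R -> \sum_(k < n) tent k t = 1.
Proof.
move=> tn; rewrite sum_tent cut_right//; last lra.
by rewrite cut_left//; lra.
Qed.

End Cut.

(** * Coordinate cylinders, supports and Lipschitz tents *)

Section Supports.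
Context {R : realType} {d : nat}.
Local Notation V := 'rV[R]_d.

Lemma open_cylinder (P : 'I_d -> set R) : (forall i, open (P i)) ->
  open [set x : V | forall i, P i (x ord0 i)].
Proof.
move=> oP; rewrite openE => x Px.
apply: (@filter_forall V _ (fun i => [set x : V | P i (x ord0 i)]) _ (nbhs_filter x)) => i.
apply: (@coord_continuous R 1 d ord0 i x (P i)).
by apply: open_nbhs_nbhs; split => //; exact: Px.
Qed.

Lemma closed_cylinder (P : 'I_d -> set R) : (forall i, closed (P i)) ->
  closed [set x : V | forall i, P i (x ord0 i)].
Proof.
move=> cP; rewrite (_ : [set _ | _] = \bigcap_i [set x : V | P i (x ord0 i)]).
  apply: closed_bigI => i _; apply: preimage_closed => //.
  by move=> x _; exact: coord_continuous.
by apply/seteqP; split => [x Px i _|x Px i]; [exact: Px|exact: (Px i I)].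
Qed.

Lemma supp_subset (f : V -> R) (A : set V) : closed A ->
  (forall x, f x != 0 -> A x) -> supp f `<=` A.
Proof. by move=> /closure_id {2}-> fA; exact: closure_subset. Qed.

Lemma is_lipb_tent k (A e : R) (i : 'I_d) : 0 < e ->
  is_lipb (fun x : V => tent k ((x ord0 i + A) / e)).
Proof.
move=> e0.
have H n : is_lipb (fun x : V => cut 0 1 ((x ord0 i + A) / e - n%:R)).
  split.
    exists e^-1; split; first by rewrite invr_ge0 ltW.
    move=> x y; apply: le_trans (cut_dist _ _ _ _) _.
    rewrite opprD addrACA subrr addr0 -mulrBl opprD addrACA subrr addr0 normrM mulrC.
    rewrite ger0_norm ?invr_ge0 ?(ltW e0)// ler_wpM2l ?invr_ge0 ?(ltW e0)//.
    by have := coord_le_enorm (x - y) i; rewrite !mxE.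
  exists 1 => x; have := @cut_itv R 0 1 ((x ord0 i + A) / e - n%:R) ler01.
  by move=> /andP[c0 c1]; rewrite ger0_norm.
have -> : (fun x : V => tent k ((x ord0 i + A) / e)) =
  fun x => cut 0 1 ((x ord0 i + A) / e - k%:R) + (-1) * cut 0 1 ((x ord0 i + A) / e - k.+1%:R).
  by apply/funext => x; rewrite mulN1r.
by apply: is_lipbD => //; exact: is_lipbZ.
Qed.

End Supports.

(** * The chain rule *)

Section ChainRule.
Context {R : realType} {d : nat}.
Local Notation V := 'rV[R]_d.
Implicit Types (f g pi rho : V -> R).

Lemma is_lipD f g : is_lip f -> is_lip g -> is_lip (fun x => f x + g x).
Proof. by move=> [C fC] [D gD]; exists (C + D); exact: lip_constD. Qed.

Lemma is_lipZ a f : is_lip f -> is_lip (fun x => a * f x).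
Proof. by move=> [C fC]; exists (`|a| * C); exact: lip_constZ. Qed.

Lemma is_lip_affine (c : 'I_d -> R) (s : seq 'I_d) :
  is_lip (fun x : V => \sum_(i <- s) c i * x ord0 i).
Proof.
elim: s => [|i s IH].
  by under eq_fun do rewrite big_nil; exists 0; exact: lip_const_cst.
under eq_fun do rewrite big_cons.
by apply: is_lipD => //; exact/is_lipZ/is_lip_coord.
Qed.

Context (T : (V -> R) -> (V -> R) -> R) (hT : metric_current1 T).

Lemma current_linl f g pi a b : is_lipb f -> is_lipb g -> is_lip pi ->
  T (fun x => a * f x + b * g x) pi = a * T f pi + b * T g pi.
Proof. by case: hT => + _; apply. Qed.

Lemma current_linr f pi rho a b : is_lipb f -> is_lip pi -> is_lip rho ->
  T f (fun x => a * pi x + b * rho x) = a * T f pi + b * T f rho.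
Proof. by case: hT => _ [+ _]; apply. Qed.

Lemma currentZl f pi a : is_lipb f -> is_lip pi ->
  T (fun x => a * f x) pi = a * T f pi.
Proof.
move=> lf lp; rewrite -[RHS]addr0 -[X in _ + X](mul0r (T f pi)) -current_linl//.
by congr (T _ pi); apply/funext => x; rewrite mul0r addr0.
Qed.

Lemma currentDl f g pi : is_lipb f -> is_lipb g -> is_lip pi ->
  T (fun x => f x + g x) pi = T f pi + T g pi.
Proof.
move=> lf lg lp; rewrite -[T f pi]mul1r -[T g pi]mul1r -current_linl//.
by congr (T _ pi); apply/funext => x; rewrite !mul1r.
Qed.

Lemma currentBl f g pi : is_lipb f -> is_lipb g -> is_lip pi ->
  T (fun x => f x - g x) pi = T f pi - T g pi.
Proof.
move=> lf lg lp; rewrite -[T f pi]mul1r -[T g pi]mul1r -mulNr -current_linl//.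
by congr (T _ pi); apply/funext => x; rewrite mul1r mulN1r.
Qed.

Lemma current0l pi : is_lip pi -> T (fun=> 0) pi = 0.
Proof.
move=> lp; rewrite -[RHS](mul0r (T (fun=> 0) pi)) -currentZl//; last exact: is_lipb_cst.
by congr (T _ pi); apply/funext => x; rewrite mul0r.
Qed.

Lemma current_suml (J : Type) (s : seq J) (F : J -> V -> R) pi :
  (forall j, is_lipb (F j)) -> is_lip pi ->
  T (fun x => \sum_(j <- s) F j x) pi = \sum_(j <- s) T (F j) pi.
Proof.
move=> lF lp; elim: s => [|j s IH].
  by under eq_fun do rewrite big_nil; rewrite big_nil current0l.
under eq_fun do rewrite big_cons.
by rewrite currentDl// ?big_cons ?IH//; exact: is_lipb_sum.
Qed.

Lemma current_affine f (c : 'I_d -> R) rho : is_lipb f -> is_lip rho ->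
  T f (fun x => \sum_i c i * x ord0 i + rho x) =
  \sum_i c i * T f (Defs.coord i) + T f rho.
Proof.
move=> lf lr; elim: (index_enum _) => [|i s IH].
  rewrite big_nil add0r; congr (T f _).
  by apply/funext => x; rewrite big_nil add0r.
rewrite big_cons -addrA -IH -[T f (fun _ => \sum_(j <- s) _ + _)]mul1r -current_linr//.
- by congr (T f _); apply/funext => x; rewrite big_cons mul1r addrA.
- exact: is_lip_coord.
- by apply: is_lipD => //; exact: is_lip_affine.
Qed.

(** The locality axiom applied to [pi - rho], which is 0 on [U]. *)
Lemma current_local f pi rho (U : set V) : is_lipb f -> is_lip pi -> is_lip rho ->
  open U -> supp f `<=` U -> (forall x, U x -> pi x = rho x) -> T f pi = T f rho.
Proof.
move=> lf lp lr oU fU E; apply/eqP; rewrite -subr_eq0.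
rewrite -[T f pi]mul1r -[T f rho]mul1r -mulNr -current_linr//; apply/eqP.
case: hT => _ [_ [_ [+ _]]]; apply => //.
  by apply: is_lipD; exact: is_lipZ.
exists U; split => //; split => //; exists 0 => x Ux.
by rewrite E// mulN1r mul1r subrr.
Qed.

Context (I : (V -> R) -> R) (m : R) (Tm : mass_bound T I m).

(* On a small cube [f] is affine up to a remainder with small gradient; composing the remainder with the
   retraction onto a larger cube makes its global Lipschitz constant small without changing [T phi]. *)
Lemma cell_estimate f (g : 'I_d -> V -> R) L M (phi : V -> R) (a : V) (w : R) : 0 < w ->
  c11 L M f g -> is_lipb phi ->
  (forall x, phi x != 0 -> forall i, a ord0 i <= x ord0 i <= a ord0 i + w) ->
  `|T phi f - \sum_i T (fun x => phi x * g i x) (Defs.coord i)| <=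
    2 * d%:R * (3 * L * w * (d%:R + 1)) * I phi.
Proof.
move=> w0 fg lphi phiw; have [L0 fl fb gl gb st _ _] := fg.
(* [eta] is the sum of [3 L w], from the second-order remainder over a step of length at most [3 w],
   and [3 L w d], from the oscillation of the gradient on a cube of side [3 w]. *)
set eta := 3 * L * w * (d%:R + 1).
have eta0 : 0 <= eta by rewrite !mulr_ge0 ?(ltW w0)// addr_ge0.
(* The enlarged cube contains the small one in its interior, which leaves room for the open
   neighbourhood in the locality axiom. *)
pose lo i := a ord0 i - w; pose hi i := a ord0 i + 2 * w.
have lohi i : lo i <= hi i by rewrite /lo /hi; lra.
pose cl (x : V) : V := \row_i cut (lo i) (hi i) (x ord0 i).
pose c i := g i a.
pose h x := f x - \sum_i c i * x ord0 i.
pose k x := h (cl x).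
have ga i (z : V) : (forall j, lo j <= z ord0 j <= hi j) -> `|g i z - c i| <= 3 * L * w * d%:R.
  move=> zb; apply: le_trans (gl i z a) _.
  have -> : 3 * L * w * d%:R = L * \sum_(j < d) 3 * w.
    by rewrite sumr_const card_ord -[_ *+ d]mulr_natl; ring.
  rewrite ler_wpM2l//; apply: le_trans (enorm_le_sum _) _; apply: ler_sum => j _.
  have := zb j; rewrite !mxE /lo /hi ler_norml; lra.
(* The retraction turns a step [s] along [e_i] into a step [s'] with [|s'| <= |s|] and
   [|s'| <= 3 w], so the quadratic error [L s'^2] is linear in [|s|]. *)
have kl : lip_const_for k (d%:R * eta).
  apply: lip_coordwise => // i x s.
  pose z := cl x; pose s' := cut (lo i) (hi i) (x ord0 i + s) - cut (lo i) (hi i) (x ord0 i).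
  have zb j : lo j <= z ord0 j <= hi j by rewrite mxE cut_itv.
  have clE : cl (x + s *: ebasis R i) = z + s' *: ebasis R i.
    apply/rowP => j; rewrite !mxE; case: eqVneq => [<-|_]; last by rewrite !mulr0 !addr0.
    by rewrite !mulr1 /s'; ring.
  have s's : `|s'| <= `|s|.
    by apply: le_trans (cut_dist _ _ _ _) _; rewrite addrC addKr.
  have s'w : `|s'| <= 3 * w.
    have := cut_itv (x ord0 i + s) (lohi i); have := cut_itv (x ord0 i) (lohi i).
    by rewrite ler_norml /s' /lo /hi; lra.
  have -> : k (x + s *: ebasis R i) - k x =
      (f (z + s' *: ebasis R i) - f z - s' * g i z) + s' * (g i z - c i).
    rewrite /k clE -/z /h.
    have -> : \sum_j c j * (z + s' *: ebasis R i) ord0 j = \sum_j c j * z ord0 j + c i * s'.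
      under eq_bigr do rewrite shiftE mulrDr.
      rewrite big_split /=; congr (_ + _); rewrite (bigD1 i)//= eqxx mulr1 big1 ?addr0//.
      by move=> j /negPf ji; rewrite eq_sym ji !mulr0.
    ring.
  apply: le_trans (ler_normD _ _) _.
  have H1 : L * s' ^+ 2 <= L * (3 * w) * `|s|.
    rewrite -mulrA ler_wpM2l// -real_normK ?num_real// expr2.
    by apply: ler_pM.
  have H2 : `|s' * (g i z - c i)| <= `|s| * (3 * L * w * d%:R).
    by rewrite normrM ler_pM// ga.
  have H3 := st i z s'.
  have -> : eta * `|s| = L * (3 * w) * `|s| + `|s| * (3 * L * w * d%:R) by rewrite /eta; ring.
  by apply: lerD => //; apply: le_trans H1.
have lk : is_lip k by exists (d%:R * eta).
have lf : is_lip f by exists L.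
have lg i : is_lipb (g i) by exact: c11_grad_is_lipb fg.
have -> : T phi f = \sum_i c i * T phi (Defs.coord i) + T phi k.
  rewrite -current_affine//.
  pose U : set V := [set x : V | forall i, `]lo i, hi i[%classic (x ord0 i)].
  have oU : open U.
    by apply: (@open_cylinder R d (fun i => `]lo i, hi i[%classic)) => i; exact: interval_open.
  apply: (@current_local _ _ _ U) => //.
  - by apply: is_lipD => //; exact: is_lip_affine.
  - apply: (@subset_trans _ [set x : V | forall i, `[a ord0 i, a ord0 i + w]%classic (x ord0 i)]).
      apply: supp_subset.
        apply: (@closed_cylinder R d (fun i => `[a ord0 i, a ord0 i + w]%classic)) => i.
        exact: interval_closed.
      by move=> x /phiw H i; rewrite /= in_itv; exact: H.
    move=> x /= H i; have := H i; rewrite /U /= /lo /hi !in_itv /=; lra.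
  - move=> x /= Ux; rewrite /k (_ : cl x = x) /h ?subrKC//.
    apply/rowP => i; rewrite mxE cut_id//; have := Ux i; rewrite /U /= in_itv /=; lra.
(* Two errors remain: the remainder [k], and the replacement of the gradient at [a] by the gradient
   at [x]. Each is at most [d eta I phi], whence the factor [2 d]. *)
have -> : \sum_i c i * T phi (Defs.coord i) + T phi k - \sum_i T (fun x => phi x * g i x) (Defs.coord i)
   = T phi k + \sum_i T (fun x => c i * phi x - phi x * g i x) (Defs.coord i).
  rewrite addrAC addrC -sumrB; congr (_ + _); apply: eq_bigr => i _.
  rewrite -currentZl//; last exact: is_lip_coord.
  rewrite -currentBl//; [exact: is_lipbZ|exact: is_lipbM|exact: is_lip_coord].
apply: le_trans (ler_normD _ _) _.
have -> : 2 * d%:R * eta * I phi = d%:R * eta * I phi + \sum_(i < d) eta * I phi.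
  by rewrite sumr_const card_ord -[_ *+ d]mulr_natl; ring.
apply: lerD; first exact: (mass_le Tm).
apply: le_trans (ler_norm_sum _ _ _) _; apply: ler_sum => i _.
have lb : is_lipb (fun x => c i * phi x - phi x * g i x).
  under eq_fun do rewrite -mulN1r.
  by apply: is_lipbD; apply: is_lipbZ => //; exact: is_lipbM.
apply: le_trans (mass_le Tm lb (lip_const_coord i)) _; rewrite mul1r.
apply: (mass_mono Tm) => // x.
have -> : c i * phi x - phi x * g i x = (c i - g i x) * phi x by ring.
rewrite normrM; have [->|/phiw px] := eqVneq (phi x) 0; first by rewrite normr0 !mulr0.
rewrite ler_wpM2r// distrC; apply: le_trans (ga i x _) _.
  by move=> j; have := px j; rewrite /lo /hi; lra.
by rewrite /eta ler_wpM2l ?mulr_ge0 ?(ltW w0)// lerDl.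
Qed.

(** Cut the constant 1 into tents on a grid of mesh [e]. Each cell has error of order [e I (Phi k)],
    and the [I (Phi k)] add up to at most [m], so the total error is of order [e <= 1 / n.+1]. *)
Lemma chain_rule f (g : 'I_d -> V -> R) L M : c11 L M f g ->
  T (fun=> 1) f = \sum_i T (g i) (Defs.coord i).
Proof.
wlog M0 : M / 0 <= M.
  by move=> H fg; apply: (H `|M|) => //; exact: c11_le (ler_norm M) fg.
move=> fg; have [L0 fl fb gl gb st sf sg] := fg.
have lf : is_lip f by exists L.
have lg i : is_lipb (g i) by exact: c11_grad_is_lipb fg.
apply/eqP; rewrite -subr_eq0 -normr_le0.
apply: (@le_of_leD_divn _ _ _ (12 * d%:R * L * (d%:R + 1) * m)) => n; rewrite add0r.
(* The tents add up to 1 where every coordinate lies in [[e - A, A]]; since [e <= 1], this contains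
   the cube of half-side [M + 1]. Taking [K > 2 A] forces [e <= 1 / n.+1]. *)
pose A : R := M + 2; pose K := (Num.trunc (2 * A)).+1; pose N := (n.+1 * K)%N.
have AK : 2 * A < K%:R by rewrite truncnS_gt.
have A0 : 0 < A by rewrite /A; lra.
have N0 : 0 < N%:R :> R by rewrite ltr0n muln_gt0.
pose e : R := 2 * A / N%:R.
have e0 : 0 < e by rewrite divr_gt0// mulr_gt0.
have eN : e * N%:R = 2 * A by rewrite divfK// gt_eqF.
have en : e <= n.+1%:R^-1.
  rewrite /e ler_pdivrMr// /N natrM mulKf ?pnatr_eq0//; exact: ltW.
have e1 : e <= 1 by apply: le_trans en _; rewrite invf_le1// ler1n.
pose Phi (k : {ffun 'I_d -> 'I_N}) (x : V) := \prod_i tent (k i) ((x ord0 i + A) / e).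
pose Psi (x : V) := \sum_k Phi k x.
have PsiE x : Psi x = \prod_(i < d) \sum_(k < N) tent k ((x ord0 i + A) / e).
  by rewrite bigA_distr_bigA.
have Phi0 k x : 0 <= Phi k x by apply: prodr_ge0 => i _; exact: tent_ge0.
have Psi1 x : Psi x <= 1.
  by rewrite PsiE; apply: prodr_ile1 => i _; exact: sum_tent_itv.
have Psi_one (x : V) : (forall i, `|x ord0 i| <= M + 1) -> Psi x = 1.
  move=> xM; rewrite PsiE big1// => i _; apply: sum_tent1.
  rewrite (ler_pdivlMr _ _ e0) mul1r (ler_pdivrMr _ _ e0) (mulrC _ e) eN.
  by have := xM i; rewrite ler_norml /A; lra.
have lPhi k : is_lipb (Phi k) by apply: is_lipb_prod => i; exact: is_lipb_tent.
have lPsi : is_lipb Psi by exact: is_lipb_sum.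
have l1 := @is_lipb_cst R d 1.
(* [1 - Psi] vanishes on the cube of half-side [M + 1], and [f] vanishes off the cube of half-side
   [M]; the gap between the two makes locality applicable. *)
have -> : T (fun=> 1) f = T Psi f.
  apply/eqP; rewrite -subr_eq0 -currentBl//; apply/eqP.
  case: (hT) => _ [_ [_ [+ _]]]; apply => //.
    by under eq_fun do rewrite -mulN1r; apply: is_lipbD => //; exact: is_lipbZ.
  pose B : set V := [set x : V | forall i, `[- M, M]%classic (x ord0 i)].
  pose B' : set V := [set x : V | forall i, `]- (M + 1), M + 1[%classic (x ord0 i)].
  exists (~` B); split.
    rewrite openC; apply: (@closed_cylinder R d (fun i => `[- M, M]%classic)) => i.
    exact: interval_closed.
  split.
    apply: (@subset_trans _ (~` B')).
      apply: supp_subset.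
        rewrite closedC; apply: (@open_cylinder R d (fun i => `]- (M + 1), M + 1[%classic)) => i.
        exact: interval_open.
      move=> x /eqP xP xB; apply: xP; rewrite Psi_one ?subrr// => i.
      by have := xB i; rewrite /= in_itv /= ler_norml; lra.
    move=> x xB' xB; apply: xB' => i; have := xB i; rewrite /= !in_itv /=; lra.
  exists 0 => x xB; apply: contrapT => fx; apply: xB => i /=.
  rewrite in_itv /= -ler_norml leNgt; apply/negP => /sf; exact: fx.
have gPsi i : g i = fun x => Psi x * g i x.
  apply/funext => x; have [xM|] := pselect (forall i, `|(x : V) ord0 i| <= M + 1).
    by rewrite Psi_one// mul1r.
  move=> /existsNP[j /negP]; rewrite -ltNge => xj.
  by rewrite (sg i x j) ?mulr0//; lra.
have -> : \sum_i T (g i) (Defs.coord i) = \sum_k \sum_i T (fun x => Phi k x * g i x) (Defs.coord i).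
  rewrite exchange_big /=; apply: eq_bigr => i _.
  rewrite {1}gPsi -current_suml.
  - by congr (T _ _); apply/funext => x; rewrite mulr_suml.
  - by move=> k; exact: is_lipbM.
  - exact: is_lip_coord.
rewrite current_suml// -sumrB.
apply: le_trans (ler_norm_sum _ _ _) _.
(* Lower corner of the support of [Phi k]; a tent spans two mesh lengths, so the cell has side
   [2 e]. *)
pose a (k : {ffun 'I_d -> 'I_N}) : V := \row_i ((k i)%:R * e - A).
have cell k : `|T (Phi k) f - \sum_i T (fun x => Phi k x * g i x) (Defs.coord i)| <=
    2 * d%:R * (3 * L * (2 * e) * (d%:R + 1)) * I (Phi k).
  apply: (cell_estimate (a := a k) _ fg) => //; first by rewrite mulr_gt0.
  move=> x Px i; have : tent (k i) ((x ord0 i + A) / e) != 0.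
    by move: Px; apply: contraNneq => t0; rewrite /Phi (bigD1 i)//= t0 mul0r.
  move=> /tent_supp; rewrite (ler_pdivlMr _ _ e0) (ler_pdivrMr _ _ e0) mxE; lra.
apply: le_trans (ler_sum _ (fun k _ => cell k)) _.
rewrite -mulr_sumr.
have PhiI : \sum_k I (Phi k) <= m by exact: (mass_sum Tm).
apply: (@le_trans _ _ (2 * d%:R * (3 * L * (2 * e) * (d%:R + 1)) * m)).
  by rewrite ler_wpM2l// !mulr_ge0// ?addr_ge0// ltW.
have -> : 2 * d%:R * (3 * L * (2 * e) * (d%:R + 1)) * m = 12 * d%:R * L * (d%:R + 1) * m * e by ring.
by rewrite ler_wpM2l// !mulr_ge0// ?addr_ge0// (mass_ge0 Tm).
Qed.

End ChainRule.

(** * Limits of bounded sequences along an ultrafilter *)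

Section GeneralizedLimit.
Context {R : realType}.

(** Along an ultrafilter finer than the eventual filter, a sequence with values in the compact
    [[-B, B]] converges to a cluster point. Bounds that hold only eventually still pass to the
    limit. *)
Lemma generalized_limit : exists Lim : (nat -> R) -> R,
  (forall (u v : nat -> R) (a b Bu Bv : R), (forall n, `|u n| <= Bu) -> (forall n, `|v n| <= Bv) ->
     Lim (fun n => a * u n + b * v n) = a * Lim u + b * Lim v) /\
  (forall (u : nat -> R) (a b B : R), (forall n, `|u n| <= B) ->
     (\forall n \near \oo, a <= u n <= b) -> a <= Lim u <= b).
Proof.
have [U [UU ooU]] := ultraFilterLemma eventually_filter.
have PU : ProperFilter U by case: UU.
have cvgU (u : nat -> R) B : (forall n, `|u n| <= B) -> cvg (u n @[n --> U]).
  move=> uB; have [l [_ lu]] : (`[- B, B]%classic `&` cluster (u @ U)) !=set0.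
    apply: segment_compact; apply: (@filterE _ U) => n.
    by rewrite /= in_itv /= -ler_norml.
  apply/cvg_ex; exists l => A Al.
  have [//|nA] := in_ultra_setVsetC (u @^-1` A) UU.
  by have [x []] := lu (~` A) A nA Al.
exists (fun u => lim (u n @[n --> U])); split.
- move=> u v a b Bu Bv uB vB; apply: cvg_lim => //.
  by apply: cvgD; apply: cvgMl_tmp; [exact: cvgU uB|exact: cvgU vB].
- move=> u a b B uB /ooU uab; have cu := cvgU u B uB; apply/andP; split.
    by apply: limr_ge => //; apply: filterS uab => n /andP[].
  by apply: limr_le => //; apply: filterS uab => n /andP[].
Qed.

End GeneralizedLimit.

(** * Flat-norm estimates *)

Section Smoothing.
Context {R : realType} {d : nat}.
Local Notation V := 'rV[R]_d.
Implicit Types (f : V -> R) (w : form1 R d).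
Context (T : (V -> R) -> (V -> R) -> R) (hT : metric_current1 T).
Context (I : (V -> R) -> R) (m : R) (Tm : mass_bound T I m).

Local Notation S := (induced_current T).

Lemma current_bnd f B i : is_lipb f -> (forall x, `|f x| <= B) ->
  `|T f (Defs.coord i)| <= B * m.
Proof.
move=> lf fB; have B0 : 0 <= B := le_trans (normr_ge0 _) (fB 0).
have l1 := @is_lipb_cst R d 1.
apply: le_trans (mass_le Tm lf (lip_const_coord i)) _; rewrite mul1r.
apply: le_trans (mass_mono Tm lf l1 B0 _) _.
  by move=> x; rewrite normr1 mulr1.
rewrite ler_wpM2l//.
(* The bound [I 1 <= m] is [mass_sum] for a family with a single member. *)
have sum_unit (a : R) : \sum_(j : unit) a = a by rewrite sumr_const card_unit.
rewrite -[leLHS]sum_unit; apply: (mass_sum Tm (Phi := fun _ _ => 1)) => // x.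
by rewrite sum_unit.
Qed.

Lemma induced_bnd w B : (forall i, is_lipb (w i)) -> (forall i x, `|w i x| <= B) ->
  `|S w| <= d%:R * (B * m).
Proof.
move=> lw wB; apply: le_trans (ler_norm_sum _ _ _) _.
have -> : d%:R * (B * m) = \sum_(i < d) B * m by rewrite sumr_const card_ord mulr_natl.
by apply: ler_sum => i _; exact: current_bnd.
Qed.

(* The continuity axiom is only sequential; uniformity over Lipschitz functions follows by contradiction. *)
Lemma current_small C eta : 0 < eta -> exists2 delta, 0 < delta &
  forall f, lip_const_for f C -> (forall x, `|f x| <= delta) -> `|T (fun=> 1) f| <= eta.
Proof.
move=> eta0; apply: contrapT => nex.
have H n : exists f, [/\ lip_const_for f C, forall x, `|f x| <= harmonic n & eta < `|T (fun=> 1) f|].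
  apply: contrapT => nf; apply: nex; exists (harmonic n); first by rewrite invr_gt0.
  move=> f lf fn; rewrite leNgt; apply/negP => Tf; apply: nf; by exists f.
have [F HF] := choice H.
have l0 : is_lip (fun _ : V => 0 : R) by exists 0; exact: lip_const_cst.
have T0 : T (fun=> 1) (fun=> 0) = 0.
  case: (hT) => _ [_ [_ [loc _]]]; apply: loc => //; first exact: is_lipb_cst.
  by exists setT; split; [exact: openT|split => //; exists 0].
have : T (fun=> 1) (F n) @[n --> \oo] --> T (fun=> 1) (fun=> 0).
  case: (hT) => _ [_ [Hc _]]; apply: (Hc _ _ _ C) => //.
  - exact: is_lipb_cst.
  - by move=> n; exists C; case: (HF n).
  - by move=> n; apply: lip_const_Lip; case: (HF n).
  - move=> x; apply/cvgrPdist_le => e e0.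
    near=> n; rewrite sub0r normrN; have [_ /(_ x) Fx _] := HF n.
    apply: le_trans Fx _; apply: le_trans (ler_norm _) _.
    by near: n; have /cvgr0_norm_le := @cvg_harmonic R; apply.
rewrite T0 => /cvgr0_norm_le/(_ _ eta0)[n _ /(_ n (leqnn n)) /=].
by have [_ _] := HF n; rewrite ltNge => /negP.
Unshelve. all: by end_near. Qed.

(** The order of quantifiers is the point: [delta] precedes [L], [M] and [w], and [L] influences
    only the number [n] of nodes, which is chosen after [w]. *)
Lemma shift_estimate eta : 0 < eta -> exists2 delta, 0 < delta <= 1 &
  forall L M w (Dw : 'I_d -> 'I_d -> V -> R), (forall i, c11 L M (w i) (Dw i)) ->
  (forall i x, `|w i x| <= 1) -> (forall i j x, `|Dw i j x - Dw j i x| <= 1) ->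
  forall j t, 0 <= t <= delta ->
  `|S (fun i x => w i (x + t *: ebasis R j)) - S w| <= eta.
Proof.
move=> eta0; have eta2 : 0 < eta / 2 by rewrite divr_gt0.
have [delta0 d00 small] := current_small (d%:R * 4) eta2.
have m0 := mass_ge0 Tm.
have dm0 : 0 < 4 * (d%:R * m + 1) by rewrite mulr_gt0// ltr_wpDl// mulr_ge0.
(* The bounds serve in turn to make [p] small enough for [current_small], to keep [t <= 1], and to
   get [d (2 delta) m <= eta / 2] for the error form [s]. *)
pose delta := Num.min (Num.min delta0 1) (eta / (4 * (d%:R * m + 1))).
have de0 : 0 < delta by rewrite !lt_min d00 ltr01 divr_gt0.
have [dd0 d1 de] : [/\ delta <= delta0, delta <= 1 & delta <= eta / (4 * (d%:R * m + 1))].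
  by rewrite /delta !ge_min !lexx ?orbT.
exists delta => [|L M w Dw wc w1 dw1 j t /andP[t0 td]]; first by rewrite de0.
have t1 : t <= 1 := le_trans td d1.
have L0 : 0 <= L by case: (wc j).
(* Enough nodes for the Riemann error [L t^2 / n.+1] to be at most [delta]. *)
pose n := Num.trunc (L / delta).
have nL : L / n.+1%:R <= delta.
  by rewrite ler_pdivrMr// mulrC -ler_pdivrMr// ltW// truncnS_gt.
pose p x := t * avg j t n (w j) x.
pose gp i x := t * avg j t n (Dw j i) x.
have t01 : 0 <= t <= 1 by rewrite t0.
have pc : c11 L (M + 1) p gp.
  by apply: c11Z; [rewrite ger0_norm|exact: c11_avg].
pose s i x := w i (x + t *: ebasis R j) - w i x - gp i x.
have sb i x : `|s i x| <= 2 * delta.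
  have -> : s i x = (w i (x + t *: ebasis R j) - w i x - t * avg j t n (Dw i j) x) +
      t * avg j t n (fun y => Dw i j y - Dw j i y) x.
    have := @avgs_lin R d [:: j] t n (Dw i j) (Dw j i) 1 (-1) x; rewrite /= !mul1r !mulN1r.
    under [X in avg _ _ _ X _]eq_fun do rewrite mul1r mulN1r.
    by move=> ->; rewrite /s /gp; ring.
  apply: le_trans (ler_normD _ _) _.
  have -> : 2 * delta = delta + delta by ring.
  apply: lerD.
    apply: le_trans (c11_riemann _ _ _ _ (wc i)) _; apply: le_trans nL.
    by rewrite ler_wpM2r ?invr_ge0// ler_piMr// expr2 mulr_ile1.
  rewrite normrM ger0_norm// -[leRHS]mulr1 ler_pM// avg_bnd// => y; exact: dw1.
(* A bound free of [L]: the gradient of [p] is an increment of [w i], at most 2, minus [s i], at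
   most [2 delta <= 2]. This is the 4 in the call to [current_small]. *)
have gpb i x : `|gp i x| <= 4.
  have -> : gp i x = w i (x + t *: ebasis R j) - w i x - s i x by rewrite /s; ring.
  apply: le_trans (ler_normB _ _) _.
  have := sb i x; have := ler_normB (w i (x + t *: ebasis R j)) (w i x).
  have := w1 i (x + t *: ebasis R j); have := w1 i x; lra.
have lw i : is_lipb (w i) by exact: c11_is_lipb (wc i).
have lgp i : is_lipb (gp i) by exact: c11_grad_is_lipb pc.
have ltw i : is_lipb (fun x => w i (x + t *: ebasis R j)).
  have [_ wl wb _ _ _ _ _] := wc i; split; last by exists L.
  exists L; split => // x y; apply: le_trans (wl _ _) _.
  by rewrite opprD addrACA subrr addr0.
have lB (f g : V -> R) : is_lipb f -> is_lipb g -> is_lipb (fun x => f x - g x).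
  by move=> lf lg; under eq_fun do rewrite -mulN1r; apply: is_lipbD => //; exact: is_lipbZ.
have ls i : is_lipb (s i) by apply: (lB) => //; exact: lB.
have -> : S (fun i x => w i (x + t *: ebasis R j)) - S w = T (fun=> 1) p + S s.
  rewrite (chain_rule hT Tm pc) /induced_current -sumrB -big_split /=.
  apply: eq_bigr => i _; have lc := @is_lip_coord R d i.
  rewrite /s !(currentBl hT)//; first ring.
  exact: lB.
have -> : eta = eta / 2 + eta / 2 by field.
apply: le_trans (ler_normD _ _) _; apply: lerD.
  apply: small.
    by apply: (c11_lip_of_grad _ pc).
  move=> x; rewrite /p normrM ger0_norm// -[leRHS]mulr1 ler_pM ?avg_bnd//.
  exact: le_trans td dd0.
apply: le_trans (induced_bnd ls sb) _.
have : 4 * (d%:R * m + 1) * delta <= eta by rewrite mulrC -ler_pdivlMr.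
have := ltW de0; lra.
Qed.

(** An average is a convex combination of shifts of length at most [t]. *)
Lemma avg_estimate L M w (Dw : 'I_d -> 'I_d -> V -> R) j n t eta :
  (forall i, c11 L M (w i) (Dw i)) -> 0 <= t ->
  (forall s, 0 <= s <= t -> `|S (fun i x => w i (x + s *: ebasis R j)) - S w| <= eta) ->
  `|S (fun i => avg j t n (w i)) - S w| <= eta.
Proof.
move=> wc t0 H.
pose sh (k : 'I_n.+1) := k%:R * (t / n.+1%:R).
have -> : S (fun i => avg j t n (w i)) - S w =
   n.+1%:R^-1 * \sum_k (S (fun i x => w i (x + sh k *: ebasis R j)) - S w).
  rewrite sumrB mulrBr mean_cst; congr (_ - _).
  rewrite /induced_current exchange_big mulr_sumr /=; apply: eq_bigr => i _.
  have [L0 wl wb _ _ _ _ _] := wc i.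
  have lw (k : 'I_n.+1) : is_lipb (fun x => w i (x + sh k *: ebasis R j)).
    split; last by exists L.
    exists L; split => // x y; apply: le_trans (wl _ _) _.
    by rewrite opprD addrACA subrr addr0.
  have lc := @is_lip_coord R d i.
  by rewrite (currentZl hT) ?(current_suml hT)//; exact: is_lipb_sum.
apply: ler_mean => k; apply: H; rewrite /sh mulr_ge0 ?divr_ge0//=.
by rewrite mulrCA ler_piMr// ler_pdivrMr// mul1r ler_nat ltnW.
Qed.

(** Average in one direction after another. Averaging preserves the bounds on [w] and [dw], and
    [delta] does not depend on [M], so the growth of the support is harmless and every stage costs
    [eta]. *)
Lemma avgs_estimate eta : 0 < eta -> exists2 delta, 0 < delta <= 1 &
  forall L M w (Dw : 'I_d -> 'I_d -> V -> R), (forall i, c11 L M (w i) (Dw i)) ->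
  (forall i x, `|w i x| <= 1) -> (forall i j x, `|Dw i j x - Dw j i x| <= 1) ->
  forall l t n, 0 <= t <= delta ->
  `|S (fun i => avgs l t n (w i)) - S w| <= (size l)%:R * eta.
Proof.
move=> /shift_estimate[delta /[dup] dl /andP[d0 d1] H]; exists delta => //.
move=> L M w Dw wc w1 dw1 l t n /andP[t0 td].
have t01 : 0 <= t <= 1 by rewrite t0 (le_trans td).
elim: l => [|j l IH]; first by rewrite mul0r subrr normr0.
rewrite /= -natr1 mulrDl mul1r.
set S1 := S _; set S0 := S w.
set S2 := S (fun i => avgs l t n (w i)) in IH *.
rewrite (_ : S1 - S0 = (S1 - S2) + (S2 - S0)); last by ring.
apply: le_trans (ler_normD _ _) _; rewrite [leRHS]addrC; apply: lerD => //.
have wcl i := c11_avgs l n t01 (wc i).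
apply: (avg_estimate _ wcl) => // s /andP[s0 st].
apply: (H _ _ _ _ wcl).
- by move=> i; exact: avgs_bnd.
- move=> i k x; have := avgs_lin l t n (Dw i k) (Dw k i) 1 (-1) x.
  rewrite mul1r mulN1r => <-; apply: avgs_bnd => y.
  by rewrite mul1r mulN1r.
- by rewrite s0 (le_trans st).
Qed.

End Smoothing.

(** * The approximating normal currents *)

Lemma zero_test_fun (R : realType) (d : nat) : test_fun (fun _ : 'rV[R]_d => 0 : R).
Proof.
have z s : Defs.iterD s (fun _ : 'rV[R]_d => 0 : R) = cst 0.
  by elim: s => //= i s ->; apply/funext => x; rewrite derive_cst.
split; last first.
  rewrite /supp (_ : [set _ | _] = set0) ?closure0; first exact: compact0.
  by apply/seteqP; split => // x /=; rewrite eqxx.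
move=> s; rewrite z; split; first exact: cst_continuous.
by move=> i x; exact: derivable_cst.
Qed.

Lemma test_form_c11 (R : realType) (d : nat) (w : form1 R d) : test_form1 w ->
  exists L M, forall i, c11 L M (w i) (fun j => partial j (w i)).
Proof.
move=> tw; have /choice [L] := fun i => test_fun_c11 (tw i).
move=> /choice [M wc].
exists (\sum_i `|L i|), (\sum_i `|M i|) => i.
have le (F : 'I_d -> R) : F i <= \sum_j `|F j|.
  by rewrite (bigD1 i)//= (le_trans (ler_norm _))// lerDl; apply: sumr_ge0.
by apply: c11_le (wc i).
Qed.

Theorem mainTheorem1 (R : realType) (d : nat) (hd : (0 < d)%N)
  (T : ('rV[R]_d -> R) -> ('rV[R]_d -> R) -> R) :
  metric_current1 T -> flat_chain1 (induced_current T).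
Proof.
move=> hT; have [I [m Tm]] := metric_current1_mass hT.
have m0 := mass_ge0 Tm.
have [Lim [Lim_lin Lim_itv]] := @generalized_limit R.
(* Running through all directions gives the grid average over the cube [x + [0, t]^d]; [N t] is its
   limit under refinement. *)
pose A t n (w : form1 R d) : form1 R d := fun i => avgs (enum 'I_d) t n (w i).
pose N t (w : form1 R d) := Lim (fun n => induced_current T (A t n w)).
have Abnd (w : form1 R d) t n B : 0 <= t <= 1 -> test_form1 w -> (forall i x, `|w i x| <= B) ->
    `|induced_current T (A t n w)| <= d%:R * (B * m).
  move=> t01 /test_form_c11[L [M wc]] wB; apply: (induced_bnd Tm) => i.
    exact: c11_is_lipb (c11_avgs _ n t01 (wc i)).
  exact: avgs_bnd.
have test_bnd (w : form1 R d) : test_form1 w -> exists B, forall i x, `|w i x| <= B.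
  by move=> /test_form_c11[L [M wc]]; exists L => i; exact: c11_bnd (wc i).
have near_all (P : nat -> Prop) : (forall n, P n) -> \forall n \near \oo, P n.
  by move=> HP; near=> n; exact: HP.
have Nnormal t : 0 < t <= 1 -> normal1 (N t).
  move=> /[dup] t01' /andP[t0 t1]; have t01 : 0 <= t <= 1 by rewrite ltW.
  split; [|split].
  - move=> w1 w2 a b tw1 tw2.
    have [B1 wB1] := test_bnd _ tw1; have [B2 wB2] := test_bnd _ tw2.
    rewrite /N -(Lim_lin _ _ _ _ _ _ (fun n => Abnd _ t n _ t01 tw1 wB1) (fun n => Abnd _ t n _ t01 tw2 wB2)).
    congr Lim; apply/funext => n; rewrite /induced_current !mulr_sumr -big_split /=.
    have [L1 [M1 wc1]] := test_form_c11 tw1; have [L2 [M2 wc2]] := test_form_c11 tw2.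
    apply: eq_bigr => i _; rewrite -(current_linl hT).
    + by congr (T _ _); apply/funext => x; exact: avgs_lin.
    + exact: c11_is_lipb (c11_avgs _ n t01 (wc1 i)).
    + exact: c11_is_lipb (c11_avgs _ n t01 (wc2 i)).
    + exact: is_lip_coord.
  - apply: (@le_lt_trans _ _ (d%:R * (1 * m))%:E); last exact: ltry.
    apply: ge_ereal_sup => _ [w [tw w1] <-]; rewrite lee_fin.
    have w1' i x : `|w i x| <= 1 by exact: comass1_le1_coord.
    have bnd n := Abnd w t n _ t01 tw w1'.
    have itv n : - (d%:R * (1 * m)) <= induced_current T (A t n w) <= d%:R * (1 * m).
      by rewrite -ler_norml.
    by have /andP[] := Lim_itv _ _ _ _ bnd (near_all _ itv).
  (* [2 / t] bounds the difference quotients, and the extra 1 absorbs the Riemann error, so that [K]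
     does not depend on [f]. *)
  - pose K := d%:R * (((1 + 1) / t + 1) * m).
    apply: (@le_lt_trans _ _ K%:E); last exact: ltry.
    apply: ge_ereal_sup => _ [f [tf f1] <-]; rewrite lee_fin.
    have [L [M fc]] := test_fun_c11 tf; have L0 := c11_ge0 fc.
    have lA n i : is_lipb (A t n (dform0 f) i).
      exact: c11_grad_is_lipb (c11_avgs (enum 'I_d) n t01 fc).
    have bnd n : `|induced_current T (A t n (dform0 f))| <= d%:R * (L * m).
      by apply: (induced_bnd Tm) => // i; apply: avgs_bnd => x; exact: c11_gbnd fc i x.
    suff itv : \forall n \near \oo, - K <= induced_current T (A t n (dform0 f)) <= K.
      by have /andP[] := Lim_itv _ _ _ _ bnd itv.
    (* How fine the grid must be depends on [f] through [L]; the generalized limit forgets this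
       threshold. *)
    exists (Num.trunc L) => // n /= Ln; rewrite -ler_norml.
    apply: (induced_bnd Tm) => // i x.
    apply: le_trans (avgs_grad_bnd n x t01' _ fc f1) _; first by rewrite mem_enum.
    rewrite lerD2l ler_pdivrMr// mul1r.
    apply: (@le_trans _ _ L); first by rewrite ler_piMr.
    apply: ltW; apply: lt_le_trans (truncnS_gt _) _.
    by rewrite ler_nat ltnS.
pose e k : R := harmonic k.
have e01 k : 0 < e k <= 1 by rewrite /e /harmonic /= invr_gt0 ltr0n /= invf_le1// ler1n.
exists (fun k => N (e k)); split; first by move=> k; exact: Nnormal.
have zt : test_form1 (fun (_ : 'I_d) (_ : 'rV[R]_d) => 0 : R) by move=> i; exact: zero_test_fun.
(* The zero form is admissible in the supremum, so the flat norm is nonnegative; this reduces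
   convergence to upper bounds. *)
have flat_ge0 k : (0 <= flat1 (fun w => induced_current T w - N (e k) w)%R)%E.
  apply: ereal_sup_ubound; exists (fun _ _ => 0) => /=.
    split => //; split.
      move=> x; apply: le_trans (enorm_le_sum _) _.
      by rewrite big1// => i _; rewrite !mxE normr0.
    move=> x u v _ _; rewrite /dform1_eval big1// => i _; rewrite big1// => j _.
    by rewrite /partial derive_cst mul0r.
  have S0 : induced_current T (fun _ _ => 0) = 0.
    by rewrite /induced_current big1// => i _; rewrite (current0l hT)//; exact: is_lip_coord.
  have [lin0 _] := Nnormal _ (e01 k).
  have := lin0 _ _ 0 0 zt zt; rewrite !mul0r addr0 S0 => ->.
  by rewrite subrr.
have small eta : 0 < eta ->
    \forall k \near \oo, (flat1 (fun w => induced_current T w - N (e k) w)%R <= eta%:E)%E.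
  move=> eta0; have d0 : 0 < d%:R :> R by rewrite ltr0n.
  (* There are [d] averaging stages, each allowed [eta / d]. *)
  have [delta /andP[de0 d1] H] := avgs_estimate hT Tm (divr_gt0 eta0 d0).
  near=> k.
  have ek : 0 <= e k <= delta.
    apply/andP; split; first by case/andP: (e01 k) => /ltW.
    apply: le_trans (ler_norm _) _; near: k.
    by have /cvgr0_norm_le := @cvg_harmonic R; apply.
  apply: ge_ereal_sup => _ [w [tw [w1 dw1]] <-]; rewrite lee_fin.
  have [L [M wc]] := test_form_c11 tw.
  have w1' i x : `|w i x| <= 1 by exact: comass1_le1_coord.
  have est n : `|induced_current T (A (e k) n w) - induced_current T w| <= eta.
    have := H _ _ _ _ wc w1' _ (enum 'I_d) (e k) n ek.
    rewrite size_enum_ord mulrC divfK ?gt_eqF//; apply => i j x.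
    exact: comass_d_le1_coord.
  have ek1 : 0 <= e k <= 1 by case/andP: (e01 k) => /ltW ->.
  have bnd n := Abnd w (e k) n _ ek1 tw w1'.
  (* The estimate holds for every grid, hence also for the limit [N (e k) w]. *)
  have itv n : induced_current T w - eta <= induced_current T (A (e k) n w) <=
      induced_current T w + eta by have := est n; rewrite ler_norml; lra.
  by have := Lim_itv _ _ _ _ bnd (near_all _ itv); rewrite -/(N (e k) w); lra.
apply/fine_cvgP; split.
  have := small 1 ltr01; apply: filterS => k k1.
  by rewrite ge0_fin_numE// (le_lt_trans k1)// ltry.
apply/cvgrPdist_le => eta eta0; have := small eta eta0; apply: filterS => k kle.
rewrite sub0r normrN /= ger0_norm ?fine_ge0// -lee_fin fineK//.
by rewrite ge0_fin_numE// (le_lt_trans kle)// ltry.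
Unshelve. all: by end_near. Qed.
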